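(* Let $V=V(\emptyset)$ be Aczel's type of (pure) iterative sets over a type-theoretic universe $U,T(\cdot)$, let $\bar R$ be the family of setoids over the setoid $(V,=_V)$ with $\bar R(\sup(a,f))=(T(a),\sim_f)$, let $\mathcal C(V,\bar R)$ be the category of setoids induced by this family, and let $\mathcal V$ be the internal category of sets in $V$ (objects: the elements of $V$; arrows: the triples $\langle\langle a,b\rangle,f\rangle$ in $V$ with $f$ a total and functional relation from $a$ to $b$). Then the categories $\mathcal C(V,\bar R)$ and $\mathcal V$ are isomorphic.
   Context: Setting: intensional Martin-Löf type theory with a universe $U$ (decoding $T(\cdot)$) closed under the usual type formers, and inductive (W-)types. Logic is propositions-as-types: propositions are types, $\exists$ is $\Sigma$, $\forall$ is $\Pi$, etc. Setoids. A setoid $A=(|A|,=_A)$ is a type $|A|$ with a (type-valued) equivalence relation; $x\in A$ means $x:|A|$. An extensional function $f:A\to B$ is a pair $(|f|,\mathrm{ext}_f)$ of $|f|:|A|\to|B|$ and a proof $\mathrm{ext}_f$ that it respects equality. $\mathrm{Ext}(A,B)$ is the setoid of extensional functions with pointwise equality $=_{\rm ext}$. A (proof-irrelevant) family $F$ of setoids over a setoid $A$ is a setoid $F(x)$ for each $x\in A$ and $F(p)\in \mathrm{Ext}(F(x),F(y))$ for each $p:x=_Ay$, such that $F(\mathrm{ref}(x))=_{\rm ext}\mathrm{id}$, $F(p)=_{\rm ext}F(q)$ for all $p,q:x=_Ay$, and $F(q)\circ F(p)=_{\rm ext}F(q\circ p)$, where $q\circ p$ is the proof of transitivity and $\mathrm{ref}(x)$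 the proof of reflexivity. Categories. A category $\mathcal C$ consists of setoids $\mathcal C_0$ (objects), $\mathcal C_1$ (arrows), $\mathcal C_2$ (composable arrows) and extensional functions $\mathsf{id}:\mathcal C_0\to\mathcal C_1$, $\mathsf{dom},\mathsf{cod}:\mathcal C_1\to\mathcal C_0$, $\mathsf{cmp},\mathsf{fst},\mathsf{snd}:\mathcal C_2\to\mathcal C_1$ satisfying: (1) $\mathsf{dom}(\mathsf{id}(x))=x$; (2) $\mathsf{cod}(\mathsf{id}(x))=x$; (3) $\mathsf{dom}(\mathsf{cmp}(u))=\mathsf{dom}(\mathsf{fst}(u))$; (4) $\mathsf{cod}(\mathsf{cmp}(u))=\mathsf{cod}(\mathsf{snd}(u))$; ($4\frac12$) $\mathsf{cod}(\mathsf{fst}(u))=\mathsf{dom}(\mathsf{snd}(u))$; (5) $\mathsf{fst}(u)=\mathsf{fst}(v)$ and $\mathsf{snd}(u)=\mathsf{snd}(v)$ imply $u=v$; (6) $\mathsf{dom}(f)=\mathsf{cod}(g)$ implies $\exists u\in\mathcal C_2(\mathsf{snd}(u)=f\wedge\mathsf{fst}(u)=g)$; (7) $\mathsf{fst}(u)=\mathsf{id}(y)$ implies $\mathsf{cmp}(u)=\mathsf{snd}(u)$; (8) $\mathsf{snd}(u)=\mathsf{id}(x)$ implies $\mathsf{cmp}(u)=\mathsf{fst}(u)$; (9) $\mathsf{fst}(w)=\mathsf{fst}(v)$, $\mathsf{snd}(v)=\mathsf{fst}(u)$, $\mathsf{snd}(u)=\mathsf{snd}(z)$, $\mathsf{snd}(w)=\mathsf{cmp}(u)$,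 $\mathsf{cmp}(v)=\mathsf{fst}(z)$ imply $\mathsf{cmp}(w)=\mathsf{cmp}(z)$. A functor $F:\mathcal B\to\mathcal C$ is a triple of extensional functions $F_k:\mathcal B_k\to\mathcal C_k$ ($k=0,1,2$) commuting with $\mathsf{id},\mathsf{dom},\mathsf{cod},\mathsf{fst},\mathsf{snd},\mathsf{cmp}$. Categories are isomorphic if there is a functor between them that has an inverse functor (equivalently, all three $F_k$ are bijections of setoids). Category of a family. For a family $F$ over $A$, $\mathcal C=\mathcal C(A,F)$ has $\mathcal C_0=A$; $\mathcal C_1=((\Sigma x,y:|A|)\mathrm{Ext}(F(x),F(y)),\sim)$ where $(x,y,f)\sim(u,v,g)$ iff there are $p:x=_Au$, $q:y=_Av$ with $F(q)\circ f=_{\rm ext}g\circ F(p)$; $\mathsf{dom}(x,y,f)=x$, $\mathsf{cod}(x,y,f)=y$, $\mathsf{id}(x)=(x,x,\mathrm{id}_{F(x)})$; $\mathcal C_2=((\Sigma h,k:|\mathcal C_1|)[\mathsf{cod}(h)=_A\mathsf{dom}(k)],\approx)$ with $(h,k,p)\approx(h',k',p')$ iff $h\sim h'$ and $k\sim k'$; $\mathsf{fst}(h,k,p)=h$, $\mathsf{snd}(h,k,p)=k$; $\mathsf{cmp}((x,y,f),(u,v,g),p)=(x,v,g\circ F(p)\circ f)$. Iterative sets. $V$ is inductively generated by: if $a:U$ and $f:T(a)\to V$ then $\sup(a,f):V$. Equality: $\sup(a,f)=_V\sup(b,g)$ iff $\forall x{:}T(a)\,\exists y{:}T(b)\; f(x)=_Vg(y)$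 and $\forall y{:}T(b)\,\exists x{:}T(a)\; f(x)=_Vg(y)$. Membership: $u\in_V\sup(a,f)$ iff $\exists x{:}T(a)\;u=_Vf(x)$. $\langle x,y\rangle$ denotes the set-theoretic (Kuratowski) ordered pair in $V$. The family $\bar R$. $\bar R(\sup(a,f))=(T(a),\sim_f)$ with $x\sim_fx'$ iff $f(x)=_Vf(x')$. For $p:\sup(a,f)=_V\sup(b,g)$, viewed as a proof of the conjunction $(\forall x{:}T(a)\,\exists y{:}T(b)\; f(x)=_Vg(y))\wedge(\forall y{:}T(b)\,\exists x{:}T(a)\; f(x)=_Vg(y))$, $\bar R(p)(x)=\pi_1(\pi_1(p)(x))$, so that $f(x)=_Vg(\bar R(p)(x))$. This is a family of setoids over $(V,=_V)$. The category $\mathcal V$. $\mathcal V_0=(V,=_V)$. $\mathcal V_1$ has underlying type $\Sigma u{\in}V.\,\mathrm{Isarrow}(u)$, where $\mathrm{Isarrow}(u)$ says $\exists a,b,f\in V$ with $u=_V\langle\langle a,b\rangle,f\rangle$ and $f$ a total and functional relation from $a$ to $b$, i.e. every $t\in_Vf$ is $=_V\langle x,y\rangle$ for some $x\in_Va$, $y\in_Vb$; for every $x\in_Va$ there is $y\in_Vb$ with $\langle x,y\rangle\in_Vf$; and $\langle x,y\rangle,\langle x,y'\rangle\in_Vf$ imply $y=_Vy'$. Equality: $(u,p)=(u',p')$ iff $u=_Vu'$. For such an arrow, $\mathsf{dom}$ is $a$ and $\mathsf{cod}$ is $b$. $\mathcal V_2$ has underlying type $\Sigma w{\in}V.\,\Sigma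 u,v{\in}\mathcal V_1.\; w=_V\langle\pi_1(u),\pi_1(v)\rangle\wedge\mathsf{cod}\,u=_V\mathsf{dom}\,v$, with equality $=_V$ of the first components $w$; $\mathsf{fst}$ and $\mathsf{snd}$ return $u$ and $v$. $\mathsf{id}(a)$ is $\langle\langle a,a\rangle,\text{identity relation on }a\rangle$ and $\mathsf{cmp}$ is given by the usual set-theoretic composition of relations. *)

(* Defs.v *)
(* Propositions are types throughout: every proposition lives in Type, [exists]
   is [sigT], conjunction is [prod].  Nothing is truncated to [Prop]. *)
From Stdlib Require Import CRelationClasses.

Set Implicit Arguments.
Unset Strict Implicit.

Declare Scope setoid_scope.
Delimit Scope setoid_scope with setoid.
Local Open Scope type_scope.
Local Open Scope setoid_scope.

(** * Setoids *)

Record setoid := Setoid {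
  carrier :> Type;
  eqs : crelation carrier;
  eqs_equiv : Equivalence eqs
}.
Arguments eqs {s} _ _.
Notation "x == y" := (eqs x y) (at level 70, no associativity) : setoid_scope.

Definition ref (A : setoid) (x : A) : x == x :=
  @Equivalence_Reflexive _ _ (eqs_equiv A) x.
Definition sym (A : setoid) (x y : A) (p : x == y) : y == x :=
  @Equivalence_Symmetric _ _ (eqs_equiv A) x y p.
Definition trans (A : setoid) (x y z : A) (p : x == y) (q : y == z) : x == z :=
  @Equivalence_Transitive _ _ (eqs_equiv A) x y z p q.

Record extfun (A B : setoid) := ExtFun {
  fn :> A -> B;
  fn_ext : forall x y : A, x == y -> fn x == fn y
}.

Definition Ext (A B : setoid) : setoid.
Proof.
refine (@Setoid (extfun A B) (fun f g => forall x : A, f x == g x) _).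
split.
- intros f x; apply ref.
- intros f g H x; apply sym, H.
- intros f g h H K x; exact (trans (H x) (K x)).
Defined.

Definition ext_id (A : setoid) : Ext A A :=
  @ExtFun A A (fun x => x) (fun x y p => p).

Definition ext_comp (A B C : setoid) (g : Ext B C) (f : Ext A B) : Ext A C :=
  @ExtFun A C (fun x => g (f x)) (fun x y p => fn_ext g (fn_ext f p)).

(** * Proof-irrelevant families of setoids *)

Record family (A : setoid) := Family {
  fam :> A -> setoid;
  tr : forall x y : A, x == y -> Ext (fam x) (fam y);
  tr_ref : forall x : A, tr (ref x) == ext_id (fam x);
  tr_irr : forall (x y : A) (p q : x == y), tr p == tr q;
  tr_trans : forall (x y z : A) (p : x == y) (q : y == z),
    ext_comp (tr q) (tr p) == tr (trans p q)
}.
Arguments tr {A} f {x y} _.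
Arguments tr_ref {A} f x _.
Arguments tr_irr {A} f {x y} p q _.
Arguments tr_trans {A} f {x y z} p q _.

(** * Categories, functors, isomorphism of categories *)

Record category := Category {
  C0 : setoid;
  C1 : setoid;
  C2 : setoid;
  idn : Ext C0 C1;
  dom : Ext C1 C0;
  cod : Ext C1 C0;
  cmp : Ext C2 C1;
  first : Ext C2 C1;
  second : Ext C2 C1;
  dom_idn : forall x : C0, dom (idn x) == x;
  cod_idn : forall x : C0, cod (idn x) == x;
  dom_cmp : forall u : C2, dom (cmp u) == dom (first u);
  cod_cmp : forall u : C2, cod (cmp u) == cod (second u);
  cod_first : forall u : C2, cod (first u) == dom (second u);
  C2_eq : forall u v : C2,
    first u == first v -> second u == second v -> u == v;
  C2_ex : forall f g : C1, dom f == cod g ->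
    {u : C2 & (second u == f) * (first u == g)};
  cmp_idl : forall (u : C2) (y : C0), first u == idn y -> cmp u == second u;
  cmp_idr : forall (u : C2) (x : C0), second u == idn x -> cmp u == first u;
  cmp_assoc : forall u v w z : C2,
    first w == first v -> second v == first u -> second u == second z ->
    second w == cmp u -> cmp v == first z -> cmp w == cmp z
}.
Arguments idn {c}.
Arguments dom {c}.
Arguments cod {c}.
Arguments cmp {c}.
Arguments first {c}.
Arguments second {c}.

Record functor (B C : category) := Functor {
  F0 : Ext (C0 B) (C0 C);
  F1 : Ext (C1 B) (C1 C);
  F2 : Ext (C2 B) (C2 C);
  F_idn : forall x : C0 B, F1 (idn x) == idn (F0 x);
  F_dom : forall f : C1 B, F0 (dom f) == dom (F1 f);
  F_cod : forall f : C1 B, F0 (cod f) == cod (F1 f);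
  F_first : forall u : C2 B, F1 (first u) == first (F2 u);
  F_second : forall u : C2 B, F1 (second u) == second (F2 u);
  F_cmp : forall u : C2 B, F1 (cmp u) == cmp (F2 u)
}.

Definition functor_id (C : category) : functor C C.
Proof.
refine (@Functor C C (ext_id _) (ext_id _) (ext_id _) _ _ _ _ _ _);
  intros; apply ref.
Defined.

Definition functor_comp (B C D : category) (G : functor C D) (F : functor B C) :
  functor B D.
Proof.
refine (@Functor B D (ext_comp (F0 G) (F0 F)) (ext_comp (F1 G) (F1 F))
          (ext_comp (F2 G) (F2 F)) _ _ _ _ _ _); intros; simpl.
- exact (trans (fn_ext (F1 G) (F_idn F x)) (F_idn G _)).
- exact (trans (fn_ext (F0 G) (F_dom F f)) (F_dom G _)).
- exact (trans (fn_ext (F0 G) (F_cod F f)) (F_cod G _)).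
- exact (trans (fn_ext (F1 G) (F_first F u)) (F_first G _)).
- exact (trans (fn_ext (F1 G) (F_second F u)) (F_second G _)).
- exact (trans (fn_ext (F1 G) (F_cmp F u)) (F_cmp G _)).
Defined.

Definition functor_eq (B C : category) (F G : functor B C) : Type :=
  (F0 F == F0 G) * (F1 F == F1 G) * (F2 F == F2 G).

Definition isomorphic (B C : category) : Type :=
  {F : functor B C & {G : functor C B &
    functor_eq (functor_comp G F) (functor_id B) *
    functor_eq (functor_comp F G) (functor_id C)}}.

(** * The category of a family of setoids *)

Section CategoryOfFamily.
Variables (A : setoid) (F : family A).

Lemma tr_tr (x y z : A) (p : x == y) (q : y == z) (r : x == z) (a : F x) :
  tr F q (tr F p a) == tr F r a.
Proof. exact (trans (tr_trans F p q a) (tr_irr F _ _ a)). Qed.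

Lemma tr_id (x : A) (p : x == x) (a : F x) : tr F p a == a.
Proof. exact (trans (tr_irr F p (ref x) a) (tr_ref F x a)). Qed.

Definition fam_arrow : Type := {x : A & {y : A & Ext (F x) (F y)}}.

Definition fam_src (h : fam_arrow) : A := projT1 h.
Definition fam_tgt (h : fam_arrow) : A := projT1 (projT2 h).
Definition fam_fun (h : fam_arrow) : Ext (F (fam_src h)) (F (fam_tgt h)) :=
  projT2 (projT2 h).
Definition mk_arrow (x y : A) (f : Ext (F x) (F y)) : fam_arrow :=
  existT _ x (existT _ y f).

Definition fam_arrow_eq (h k : fam_arrow) : Type :=
  {p : fam_src h == fam_src k & {q : fam_tgt h == fam_tgt k &
     ext_comp (tr F q) (fam_fun h) == ext_comp (fam_fun k) (tr F p)}}.

Definition fam_C1 : setoid.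
Proof.
refine (@Setoid fam_arrow fam_arrow_eq _); split.
- intros [x [y f]]; exists (ref x), (ref y); intro a; simpl.
  refine (trans (tr_ref F y _) (fn_ext f _)); exact (sym (tr_ref F x a)).
- intros [x [y f]] [u [v g]] [p [q H]]; simpl in *.
  exists (sym p), (sym q); intro a; simpl in *.
  pose proof (H (tr F (sym p) a)) as E; simpl in E.
  refine (trans (fn_ext (tr F (sym q)) _) (trans _ (tr_id (trans q (sym q)) _))).
  + refine (trans (fn_ext g _) (sym E)).
    exact (sym (trans (tr_tr _ _ (ref u) a) (tr_id _ _))).
  + apply tr_tr.
- intros [x [y f]] [u [v g]] [z [w h]] [p [q H]] [p' [q' H']]; simpl in *.
  exists (trans p p'), (trans q q'); intro a; simpl in *.
  refine (trans (sym (tr_tr q q' _ _)) _).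
  refine (trans (fn_ext (tr F q') (H a)) _).
  refine (trans (H' _) _); apply (fn_ext h); apply tr_tr.
Defined.

Definition fam_dom : Ext fam_C1 A := @ExtFun fam_C1 A fam_src (fun h k e => projT1 e).
Definition fam_cod : Ext fam_C1 A :=
  @ExtFun fam_C1 A fam_tgt (fun h k e => projT1 (projT2 e)).

Definition fam_idn : Ext A fam_C1.
Proof.
refine (@ExtFun A fam_C1 (fun x => mk_arrow (ext_id (F x))) _).
intros x y p; exists p, p; intro a; apply ref.
Defined.

Definition fam_C2 : setoid.
Proof.
refine (@Setoid {h : fam_C1 & {k : fam_C1 & fam_cod h == fam_dom k}}
  (fun u v => (projT1 u == projT1 v) * (projT1 (projT2 u) == projT1 (projT2 v))) _).
split.
- intros u; split; apply ref.
- intros u v [H K]; split; apply sym; assumption.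
- intros u v w [H K] [H' K']; split; eapply trans; eassumption.
Defined.

Definition fam_first : Ext fam_C2 fam_C1 :=
  @ExtFun fam_C2 fam_C1 (fun u => projT1 u) (fun u v e => fst e).
Definition fam_second : Ext fam_C2 fam_C1 :=
  @ExtFun fam_C2 fam_C1 (fun u => projT1 (projT2 u)) (fun u v e => snd e).

Definition fam_cmp : Ext fam_C2 fam_C1.
Proof.
refine (@ExtFun fam_C2 fam_C1
  (fun u => let h := projT1 u in let k := projT1 (projT2 u) in
            let p := projT2 (projT2 u) in
     mk_arrow (ext_comp (fam_fun k) (ext_comp (tr F p) (fam_fun h)))) _).
intros [[x [y f]] [[u [v g]] p]] [[x' [y' f']] [[u' [v' g']] p']]
  [[p1 [p2 H]] [q1 [q2 K]]]; simpl in *.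
exists p1, q2; intro a; simpl in *.
refine (trans (K _) (fn_ext g' _)).
refine (trans (tr_tr p q1 (trans p q1) _) _).
refine (trans (sym (tr_tr p2 p' (trans p q1) _)) _).
apply (fn_ext (tr F p')); exact (H a).
Defined.

Lemma fam_cmp_idl (u : fam_C2) (y : A) :
  fam_first u == fam_idn y -> fam_cmp u == fam_second u.
Proof.
destruct u as [[x [z f]] [[u [v g]] p]]; intros [p1 [p2 H]]; simpl in *.
exists (trans p1 (trans (sym p2) p)), (ref v); intro a; simpl in *.
refine (trans (tr_id _ _) (fn_ext g _)).
refine (trans (sym (tr_tr p2 (trans (sym p2) p) p _)) _).
refine (trans (fn_ext (tr F _) (H a)) _); apply tr_tr.
Qed.

Lemma fam_cmp_idr (u : fam_C2) (y : A) :
  fam_second u == fam_idn y -> fam_cmp u == fam_first u.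
Proof.
destruct u as [[x [z f]] [[u [v g]] p]]; intros [p1 [p2 H]]; simpl in *.
exists (ref x), (trans p2 (sym (trans p p1))); intro a; simpl in *.
refine (trans (sym (tr_tr p2 (sym (trans p p1)) _ _)) _).
refine (trans (fn_ext (tr F _) (H _)) _).
refine (trans (fn_ext (tr F _) (tr_tr p p1 (trans p p1) _)) _).
refine (trans (tr_tr _ _ (ref z) _) _).
refine (trans (tr_id _ _) (fn_ext f _)); apply sym, tr_id.
Qed.

Lemma fam_cmp_assoc (u v w z : fam_C2) :
  fam_first w == fam_first v -> fam_second v == fam_first u ->
  fam_second u == fam_second z -> fam_second w == fam_cmp u ->
  fam_cmp v == fam_first z -> fam_cmp w == fam_cmp z.
Proof.
intros H1 H2 H3 H4 H5.
destruct v as [h [k p]].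
pose (l := fam_second u).
assert (r : fam_cod k == fam_dom l).
{ refine (trans (fn_ext fam_cod H2) _); exact (projT2 (projT2 u)). }
pose (kl := existT _ k (existT _ l r) : fam_C2).
assert (E : fam_cmp u == fam_cmp kl).
{ apply (fn_ext fam_cmp); split; [exact (sym H2)|exact (ref l)]. }
pose (w' := existT _ h (existT _ (fam_cmp kl) p) : fam_C2).
pose (hk := existT _ h (existT _ k p) : fam_C2).
pose (z' := existT _ (fam_cmp hk) (existT _ l r) : fam_C2).
refine (trans (y := fam_cmp w') (fn_ext fam_cmp _) _).
{ split; [exact H1|exact (trans H4 E)]. }
refine (trans (y := fam_cmp z') _ (fn_ext fam_cmp _)).
2:{ split; [exact H5|exact H3]. }
apply ref.
Qed.

Definition cat_of_family : category.
Proof.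
refine (@Category A fam_C1 fam_C2 fam_idn fam_dom fam_cod fam_cmp
          fam_first fam_second _ _ _ _ _ _ _ _ _ _).
- intro x; apply ref.
- intro x; apply ref.
- intro u; apply ref.
- intro u; apply ref.
- intro u; exact (projT2 (projT2 u)).
- intros u v H K; exact (H, K).
- intros f g p; exists (existT _ g (existT _ f (sym p))); split; apply ref.
- exact fam_cmp_idl.
- exact fam_cmp_idr.
- exact fam_cmp_assoc.
Defined.

End CategoryOfFamily.

(** * Iterative sets *)

(* The universe is one of Rocq's predicative universes, so the decoding T is
   the identity. *)
Definition U := Type.

Inductive V : Type := sup (a : U) (f : a -> V).
Arguments sup a f : clear implicits.

Definition index (u : V) : U := match u with sup a _ => a end.
Definition elt (u : V) : index u -> V :=
  match u with sup a f => f end.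
Arguments elt : clear implicits.

(* The result type U makes equality, hence membership, small: this is what
   allows composites of relations to be formed as elements of V. *)
Fixpoint eqV (u v : V) : U :=
  match u, v with
  | sup a f, sup b g =>
      (forall x : a, {y : b & eqV (f x) (g y)}) *
      (forall y : b, {x : a & eqV (f x) (g y)})
  end.

Definition memV (u v : V) : U :=
  match v with sup a f => {x : a & eqV u (f x)} end.

Lemma eqV_refl (u : V) : eqV u u.
Proof. induction u as [a f IH]; split; intro x; exists x; apply IH. Defined.

Lemma eqV_sym (u v : V) : eqV u v -> eqV v u.
Proof.
revert v; induction u as [a f IH]; intros [b g] [H K]; split.
- intro y; destruct (K y) as [x E]; exists x; apply IH, E.
- intro x; destruct (H x) as [y E]; exists y; apply IH, E.
Defined.

Lemma eqV_trans (u v w : V) : eqV u v -> eqV v w -> eqV u w.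
Proof.
revert v w; induction u as [a f IH]; intros [b g] [c h] [H K] [H' K']; split.
- intro x; destruct (H x) as [y E]; destruct (H' y) as [z E'].
  exists z; exact (IH _ _ _ E E').
- intro z; destruct (K' z) as [y E']; destruct (K y) as [x E].
  exists x; exact (IH _ _ _ E E').
Defined.

Definition setoidV : setoid.
Proof.
refine (@Setoid V eqV _); split.
- exact eqV_refl.
- exact eqV_sym.
- exact eqV_trans.
Defined.

(** ** The family of setoids over V *)

Definition Rbar_obj (u : V) : setoid.
Proof.
refine (@Setoid (index u) (fun x y => eqV (elt u x) (elt u y)) _); split.
- intros x; apply eqV_refl.
- intros x y; apply eqV_sym.
- intros x y z; apply eqV_trans.
Defined.

Definition Rbar_fn (u v : V) : eqV u v -> index u -> index v :=
  match u, v with sup a f, sup b g => fun p x => projT1 (fst p x) end.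

Lemma Rbar_fnP (u v : V) (p : eqV u v) (x : index u) :
  eqV (elt u x) (elt v (Rbar_fn p x)).
Proof. destruct u as [a f], v as [b g]; exact (projT2 (fst p x)). Qed.

Definition Rbar_tr (u v : V) (p : eqV u v) : Ext (Rbar_obj u) (Rbar_obj v).
Proof.
refine (@ExtFun (Rbar_obj u) (Rbar_obj v) (Rbar_fn p) _).
intros x y e; simpl in *.
exact (eqV_trans (eqV_sym (Rbar_fnP p x)) (eqV_trans e (Rbar_fnP p y))).
Defined.

Definition Rbar : family setoidV.
Proof.
refine (@Family setoidV Rbar_obj Rbar_tr _ _ _).
- intros u x; exact (eqV_sym (Rbar_fnP _ x)).
- intros u v p q x; exact (eqV_trans (eqV_sym (Rbar_fnP p x)) (Rbar_fnP q x)).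
- intros u v w p q x; simpl in *.
  exact (eqV_trans (eqV_sym (Rbar_fnP q (Rbar_fn p x)))
          (eqV_trans (eqV_sym (Rbar_fnP p x)) (Rbar_fnP (eqV_trans p q) x))).
Defined.

Local Arguments eqV : simpl never.
Local Arguments memV : simpl never.

(** ** Pairs *)

Definition pairV (x y : V) : V := sup bool (fun b : bool => if b then x else y).
Definition opair (x y : V) : V := pairV (pairV x x) (pairV x y).
Notation "⟨ x , y ⟩" := (opair x y) (at level 0, format "⟨ x ,  y ⟩").

Lemma memV_elt (u : V) (i : index u) : memV (elt u i) u.
Proof. destruct u as [a f]; exists i; apply eqV_refl. Qed.

Lemma memV_inv (x u : V) : memV x u -> {i : index u & eqV x (elt u i)}.
Proof. destruct u as [a f]; exact (fun m => m). Qed.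

Lemma memV_eql (x y u : V) : eqV x y -> memV y u -> memV x u.
Proof. destruct u as [a f]; intros e [i m]; exists i; exact (eqV_trans e m). Qed.

Lemma memV_eqr (x u v : V) : eqV u v -> memV x u -> memV x v.
Proof.
destruct u as [a f], v as [b g]; intros [H _] [i m].
destruct (H i) as [j e]; exists j; exact (eqV_trans m e).
Qed.

Lemma eqV_ext (u v : V) :
  (forall t, memV t u -> memV t v) -> (forall t, memV t v -> memV t u) -> eqV u v.
Proof.
destruct u as [a f], v as [b g]; intros H K; split.
- intro x; exact (H (f x) (@memV_elt (sup a f) x)).
- intro y; destruct (K (g y) (@memV_elt (sup b g) y)) as [x e].
  exists x; exact (eqV_sym e).
Qed.

Lemma pairV_inv (x y x' y' : V) : eqV (pairV x y) (pairV x' y') ->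
  (eqV x x' + eqV x y') * (eqV y x' + eqV y y') *
  (eqV x x' + eqV y x') * (eqV x y' + eqV y y').
Proof.
intros [H K]; repeat split.
- destruct (H true) as [[|] e]; [left|right]; exact e.
- destruct (H false) as [[|] e]; [left|right]; exact e.
- destruct (K true) as [[|] e]; [left|right]; exact e.
- destruct (K false) as [[|] e]; [left|right]; exact e.
Qed.

Lemma pairV_eq (x y x' y' : V) :
  eqV x x' -> eqV y y' -> eqV (pairV x y) (pairV x' y').
Proof.
intros e e'; split; intros [|];
  [exists true|exists false|exists true|exists false]; assumption.
Qed.

Lemma opair_eq (x y x' y' : V) :
  eqV x x' -> eqV y y' -> eqV ⟨x, y⟩ ⟨x', y'⟩.
Proof. intros e e'; repeat apply pairV_eq; assumption. Qed.

Lemma opair_inj (x y x' y' : V) :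
  eqV ⟨x, y⟩ ⟨x', y'⟩ -> eqV x x' * eqV y y'.
Proof.
intro H; destruct (pairV_inv H) as [[[H1 H2] _] H4].
assert (E : eqV x x').
{ destruct H1 as [e|e]; destruct (pairV_inv e) as [[[_ _] [k|k]] _]; exact k. }
split; [exact E|].
assert (S : eqV y x' -> eqV y y').
{ intro k; destruct H4 as [e|e]; destruct (pairV_inv e) as [_ [l|l]]; try exact l;
  exact (eqV_trans k (eqV_trans (eqV_sym E) l)). }
destruct H2 as [e|e]; destruct (pairV_inv e) as [[[_ [k|k]] _] _];
  (exact k || exact (S k)).
Qed.

(** ** The category of sets in V *)

Definition total_functional (a b f : V) : Type :=
  (forall t, memV t f ->
     {x : V & {y : V & memV x a * memV y b * eqV t ⟨x, y⟩}}) *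
  (forall x, memV x a -> {y : V & memV y b * memV ⟨x, y⟩ f}) *
  (forall x y y', memV ⟨x, y⟩ f -> memV ⟨x, y'⟩ f -> eqV y y').

Definition isarrow (u : V) : Type :=
  {a : V & {b : V & {f : V & eqV u ⟨⟨a, b⟩, f⟩ * total_functional a b f}}}.

Definition V1 : setoid.
Proof.
refine (@Setoid {u : V & isarrow u} (fun u v => eqV (projT1 u) (projT1 v)) _); split.
- intros x; apply eqV_refl.
- intros x y; apply eqV_sym.
- intros x y z; apply eqV_trans.
Defined.

Definition srcV (u : V1) : V := projT1 (projT2 u).
Definition tgtV (u : V1) : V := projT1 (projT2 (projT2 u)).
Definition relV (u : V1) : V := projT1 (projT2 (projT2 (projT2 u))).

Lemma V1_pair (u : V1) : eqV (projT1 u) ⟨⟨srcV u, tgtV u⟩, relV u⟩.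
Proof. destruct u as [u [a [b [f [e t]]]]]; exact e. Qed.

Lemma V1_tf (u : V1) : total_functional (srcV u) (tgtV u) (relV u).
Proof. destruct u as [u [a [b [f [e t]]]]]; exact t. Qed.

Lemma V1_inj (u v : V1) : u == v ->
  eqV (srcV u) (srcV v) * eqV (tgtV u) (tgtV v) * eqV (relV u) (relV v).
Proof.
intro e.
pose proof (eqV_trans (eqV_sym (V1_pair u)) (eqV_trans e (V1_pair v))) as H.
apply opair_inj in H; destruct H as [H K]; apply opair_inj in H.
exact (H, K).
Qed.

Lemma V1_eq (u v : V1) :
  eqV (srcV u) (srcV v) -> eqV (tgtV u) (tgtV v) -> eqV (relV u) (relV v) -> u == v.
Proof.
intros H K L; apply (eqV_trans (V1_pair u)).
apply (fun e => eqV_trans e (eqV_sym (V1_pair v))).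
apply opair_eq; [apply opair_eq|]; assumption.
Qed.

Definition mkV1 (a b f : V) (t : total_functional a b f) : V1 :=
  existT _ ⟨⟨a, b⟩, f⟩
    (existT _ a (existT _ b (existT _ f (eqV_refl _, t)))).

Definition domV : Ext V1 setoidV :=
  @ExtFun V1 setoidV srcV (fun u v e => fst (fst (V1_inj e))).
Definition codV : Ext V1 setoidV :=
  @ExtFun V1 setoidV tgtV (fun u v e => snd (fst (V1_inj e))).

Definition id_rel (a : V) : V := sup (index a) (fun i : index a => ⟨elt a i, elt a i⟩).

Lemma id_relP (a x y : V) : memV ⟨x, y⟩ (id_rel a) -> eqV x y.
Proof.
intros [i e]; apply opair_inj in e; destruct e as [e e'].
exact (eqV_trans e (eqV_sym e')).
Qed.

Lemma id_rel_tf (a : V) : total_functional a a (id_rel a).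
Proof.
repeat split.
- intros t [i e]; exists (elt a i), (elt a i); repeat split; try apply memV_elt; exact e.
- intros x m; destruct (memV_inv m) as [i e]; exists x; split; [exact m|].
  exists i; apply opair_eq; exact e.
- intros x y y' m m'; exact (eqV_trans (eqV_sym (id_relP m)) (id_relP m')).
Qed.

Definition idnV : Ext setoidV V1.
Proof.
refine (@ExtFun setoidV V1 (fun a => mkV1 (id_rel_tf a)) _).
assert (S : forall a b, eqV a b -> forall t, memV t (id_rel a) -> memV t (id_rel b)).
{ intros a b e t [i m].
  destruct (memV_inv (memV_eqr e (memV_elt i))) as [j k].
  exists j; apply (eqV_trans m), opair_eq; exact k. }
intros a b e; apply V1_eq; simpl; try exact e.
apply eqV_ext; apply S; [|apply eqV_sym]; exact e.
Defined.

Definition V2 : setoid.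
Proof.
refine (@Setoid
  {w : V & {u : V1 & {v : V1 &
     eqV w ⟨projT1 u, projT1 v⟩ * eqV (codV u) (domV v)}}}
  (fun w w' => eqV (projT1 w) (projT1 w')) _); split.
- intros x; apply eqV_refl.
- intros x y; apply eqV_sym.
- intros x y z; apply eqV_trans.
Defined.

Definition V2_fst (w : V2) : V1 := projT1 (projT2 w).
Definition V2_snd (w : V2) : V1 := projT1 (projT2 (projT2 w)).

Lemma V2_pair (w : V2) :
  eqV (projT1 w) ⟨projT1 (V2_fst w), projT1 (V2_snd w)⟩.
Proof. destruct w as [w [u [v [e p]]]]; exact e. Qed.

Lemma V2_composable (w : V2) : eqV (codV (V2_fst w)) (domV (V2_snd w)).
Proof. destruct w as [w [u [v [e p]]]]; exact p. Qed.

Lemma V2_inj (w w' : V2) : w == w' ->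
  (V2_fst w == V2_fst w') * (V2_snd w == V2_snd w').
Proof.
intro e; apply opair_inj.
exact (eqV_trans (eqV_sym (V2_pair w)) (eqV_trans e (V2_pair w'))).
Qed.

Lemma V2_eq (w w' : V2) :
  V2_fst w == V2_fst w' -> V2_snd w == V2_snd w' -> w == w'.
Proof.
intros e e'; apply (eqV_trans (V2_pair w)).
apply (fun k => eqV_trans k (eqV_sym (V2_pair w'))), opair_eq; assumption.
Qed.

Definition firstV : Ext V2 V1 :=
  @ExtFun V2 V1 V2_fst (fun w w' e => fst (V2_inj e)).
Definition secondV : Ext V2 V1 :=
  @ExtFun V2 V1 V2_snd (fun w w' e => snd (V2_inj e)).

(* { ⟨x, z⟩ | x ∈ a, z ∈ c, and ⟨x, y⟩ ∈ f, ⟨y, z⟩ ∈ g for some y ∈ b } *)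
Definition comp_rel (a b c f g : V) : V :=
  sup {i : index a & {k : index c & {j : index b &
          memV ⟨elt a i, elt b j⟩ f * memV ⟨elt b j, elt c k⟩ g}}}
       (fun s => ⟨elt a (projT1 s), elt c (projT1 (projT2 s))⟩).

Lemma tf_mem (a b f x y : V) :
  total_functional a b f -> memV ⟨x, y⟩ f -> memV x a * memV y b.
Proof.
intros [[H _] _] m; destruct (H _ m) as [x' [y' [[k l] e]]].
apply opair_inj in e; destruct e as [e e'].
split; eapply memV_eql; eassumption.
Qed.

Lemma comp_relI (a b b' c f g x y z : V) :
  total_functional a b f -> total_functional b' c g ->
  memV ⟨x, y⟩ f -> memV ⟨y, z⟩ g -> memV ⟨x, z⟩ (comp_rel a b c f g).
Proof.
intros tf tg m n.
destruct (tf_mem tf m) as [mx my]; destruct (tf_mem tg n) as [_ mz].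
destruct (memV_inv mx) as [i ei]; destruct (memV_inv my) as [j ej].
destruct (memV_inv mz) as [k ek].
assert (m' : memV ⟨elt a i, elt b j⟩ f).
{ refine (memV_eql _ m); apply opair_eq; apply eqV_sym; assumption. }
assert (n' : memV ⟨elt b j, elt c k⟩ g).
{ refine (memV_eql _ n); apply opair_eq; apply eqV_sym; assumption. }
exists (existT _ i (existT _ k (existT _ j (m', n')))); apply opair_eq; assumption.
Qed.

Lemma comp_relE (a b c f g t : V) : memV t (comp_rel a b c f g) ->
  {x : V & {y : V & {z : V &
     eqV t ⟨x, z⟩ * memV ⟨x, y⟩ f * memV ⟨y, z⟩ g}}}.
Proof.
intros [[i [k [j [m n]]]] e]; exists (elt a i), (elt b j), (elt c k).
repeat split; assumption.
Qed.

Lemma comp_rel_tf (a b b' c f g : V) :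
  total_functional a b f -> total_functional b' c g -> eqV b b' ->
  total_functional a c (comp_rel a b c f g).
Proof.
intros tf tg e; repeat split.
- intros t m; destruct (comp_relE m) as [x [y [z [[k l] n]]]].
  exists x, z; repeat split.
  + exact (fst (tf_mem tf l)).
  + exact (snd (tf_mem tg n)).
  + exact k.
- intros x m; destruct (snd (fst tf) x m) as [y [my l]].
  destruct (snd (fst tg) y (memV_eqr e my)) as [z [mz n]].
  exists z; split; [exact mz|exact (comp_relI tf tg l n)].
- intros x z z' m m'.
  destruct (comp_relE m) as [x1 [y1 [z1 [[k l] n]]]].
  destruct (comp_relE m') as [x2 [y2 [z2 [[k' l'] n']]]].
  apply opair_inj in k, k'; destruct k as [kx kz], k' as [kx' kz'].
  assert (ey : eqV y1 y2).
  { apply (snd tf x1); [exact l|].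
    refine (memV_eql _ l'); apply opair_eq; [|apply eqV_refl].
    exact (eqV_trans (eqV_sym kx) kx'). }
  apply (eqV_trans kz), (fun q => eqV_trans q (eqV_sym kz')).
  apply (snd tg y1); [exact n|].
  refine (memV_eql _ n'); apply opair_eq; [exact ey|apply eqV_refl].
Qed.

Definition V2_comp (w : V2) : V1 :=
  mkV1 (comp_rel_tf (V1_tf (V2_fst w)) (V1_tf (V2_snd w)) (V2_composable w)).

Lemma comp_memI (w : V2) (x y z : V) :
  memV ⟨x, y⟩ (relV (V2_fst w)) -> memV ⟨y, z⟩ (relV (V2_snd w)) ->
  memV ⟨x, z⟩ (relV (V2_comp w)).
Proof. exact (comp_relI (V1_tf (V2_fst w)) (V1_tf (V2_snd w))). Qed.

Lemma comp_memE (w : V2) (t : V) : memV t (relV (V2_comp w)) ->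
  {x : V & {y : V & {z : V & eqV t ⟨x, z⟩ *
     memV ⟨x, y⟩ (relV (V2_fst w)) * memV ⟨y, z⟩ (relV (V2_snd w))}}}.
Proof. exact (@comp_relE _ _ _ _ _ t). Qed.

Lemma V1_mem (u v : V1) (t : V) : u == v -> memV t (relV u) -> memV t (relV v).
Proof. intro e; apply memV_eqr; exact (snd (V1_inj e)). Qed.

Lemma V2_comp_sub (w w' : V2) :
  V2_fst w == V2_fst w' -> V2_snd w == V2_snd w' ->
  forall t, memV t (relV (V2_comp w)) -> memV t (relV (V2_comp w')).
Proof.
intros e e' t m; destruct (comp_memE m) as [x [y [z [[k l] n]]]].
apply (memV_eql k); apply (@comp_memI w' x y z); eapply V1_mem; eassumption.
Qed.

Definition cmpV : Ext V2 V1.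
Proof.
refine (@ExtFun V2 V1 V2_comp _).
intros w w' e; apply V2_inj in e; destruct e as [e e'].
apply V1_eq.
- exact (fst (fst (V1_inj e))).
- exact (snd (fst (V1_inj e'))).
- apply eqV_ext; apply V2_comp_sub; try assumption; apply sym; assumption.
Defined.

Lemma tf_inv (u : V1) (t : V) : memV t (relV u) ->
  {x : V & {y : V & memV x (srcV u) * memV y (tgtV u) * eqV t ⟨x, y⟩}}.
Proof. exact (fst (fst (V1_tf u)) t). Qed.

Lemma idnV_memI (a x : V) : memV x a -> memV ⟨x, x⟩ (relV (idnV a)).
Proof.
intro m; destruct (memV_inv m) as [i e]; exists i; apply opair_eq; exact e.
Qed.

Lemma idnV_memE (u : V1) (a x y : V) :
  u == idnV a -> memV ⟨x, y⟩ (relV u) -> eqV x y.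
Proof. intros e m; exact (id_relP (V1_mem e m)). Qed.

Lemma cmpV_idl (w : V2) (a : setoidV) :
  firstV w == idnV a -> cmpV w == secondV w.
Proof.
intro e; change (V2_fst w == idnV a) in e.
destruct (V1_inj e) as [[ea eb] _]; simpl in ea, eb.
pose proof (V2_composable w) as c; simpl in c.
assert (ac : eqV (srcV (V2_fst w)) (srcV (V2_snd w))).
{ exact (eqV_trans ea (eqV_trans (eqV_sym eb) c)). }
apply V1_eq; simpl.
- exact ac.
- apply eqV_refl.
- apply eqV_ext; intros t m.
  + destruct (comp_memE m) as [x [y [z [[k l] n]]]].
    apply (memV_eql k).
    refine (memV_eql _ n); apply opair_eq; [|apply eqV_refl].
    exact (idnV_memE e l).
  + destruct (tf_inv m) as [x [y [[mx my] k]]].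
    apply (memV_eql k); apply (@comp_memI w x x y).
    * apply (V1_mem (sym e)), idnV_memI.
      apply (memV_eqr ea), (memV_eqr (eqV_sym ac)), mx.
    * exact (memV_eql (eqV_sym k) m).
Qed.

Lemma cmpV_idr (w : V2) (a : setoidV) :
  secondV w == idnV a -> cmpV w == firstV w.
Proof.
intro e; change (V2_snd w == idnV a) in e.
destruct (V1_inj e) as [[ea eb] _]; simpl in ea, eb.
pose proof (V2_composable w) as c; simpl in c.
apply V1_eq; simpl.
- apply eqV_refl.
- exact (eqV_trans eb (eqV_trans (eqV_sym ea) (eqV_sym c))).
- apply eqV_ext; intros t m.
  + destruct (comp_memE m) as [x [y [z [[k l] n]]]].
    apply (memV_eql k).
    refine (memV_eql _ l); apply opair_eq; [apply eqV_refl|].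
    exact (eqV_sym (idnV_memE e n)).
  + destruct (tf_inv m) as [x [y [[mx my] k]]].
    apply (memV_eql k); apply (@comp_memI w x y y).
    * exact (memV_eql (eqV_sym k) m).
    * apply (V1_mem (sym e)), idnV_memI.
      apply (memV_eqr ea), (memV_eqr c), my.
Qed.

Lemma cmpV_assoc (u v w z : V2) :
  firstV w == firstV v -> secondV v == firstV u ->
  secondV u == secondV z -> secondV w == cmpV u ->
  cmpV v == firstV z -> cmpV w == cmpV z.
Proof.
intros H1 H2 H3 H4 H5.
change (V2_fst w == V2_fst v) in H1; change (V2_snd v == V2_fst u) in H2.
change (V2_snd u == V2_snd z) in H3; change (V2_snd w == V2_comp u) in H4.
change (V2_comp v == V2_fst z) in H5.
apply V1_eq; simpl.
- exact (eqV_trans (fst (fst (V1_inj H1))) (fst (fst (V1_inj H5)))).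
- exact (eqV_trans (snd (fst (V1_inj H4))) (snd (fst (V1_inj H3)))).
- apply eqV_ext; intros t m.
  + destruct (comp_memE m) as [x [y [r [[k l] n]]]].
    destruct (comp_memE (V1_mem H4 n)) as [y' [s [r' [[k' l'] n']]]].
    apply opair_inj in k'; destruct k' as [ky kr].
    apply (memV_eql k); apply (@comp_memI z x s r).
    * apply (V1_mem H5), (@comp_memI v x y s); [exact (V1_mem H1 l)|].
      apply (V1_mem (sym H2)); refine (memV_eql _ l').
      apply opair_eq; [exact ky|apply eqV_refl].
    * apply (V1_mem H3); refine (memV_eql _ n').
      apply opair_eq; [apply eqV_refl|exact kr].
  + destruct (comp_memE m) as [x [s [r [[k l] n]]]].
    destruct (comp_memE (V1_mem (sym H5) l)) as [x' [y [s' [[k' l'] n']]]].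
    apply opair_inj in k'; destruct k' as [kx ks].
    apply (memV_eql k); apply (@comp_memI w x y r).
    * apply (V1_mem (sym H1)); refine (memV_eql _ l').
      apply opair_eq; [exact kx|apply eqV_refl].
    * apply (V1_mem (sym H4)), (@comp_memI u y s r).
      -- apply (V1_mem H2); refine (memV_eql _ n').
         apply opair_eq; [apply eqV_refl|exact ks].
      -- exact (V1_mem (sym H3) n).
Qed.

Definition Vcat : category.
Proof.
refine (@Category setoidV V1 V2 idnV domV codV cmpV firstV secondV
          _ _ _ _ _ _ _ _ _ _).
- intro a; apply eqV_refl.
- intro a; apply eqV_refl.
- intro w; apply eqV_refl.
- intro w; apply eqV_refl.
- exact V2_composable.
- exact V2_eq.
- intros f g e.
  exists (existT _ ⟨projT1 g, projT1 f⟩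
            (existT _ g (existT _ f (eqV_refl _, eqV_sym e)))).
  split; apply eqV_refl.
- exact cmpV_idl.
- exact cmpV_idr.
- exact cmpV_assoc.
Defined.

(* Main.v *)
(* A function between the index types of two iterative sets, extensional for
   the equality of their elements, is sent to its graph in V.  Conversely a
   total functional relation in V yields such a function because, propositions
   being types, its totality proof already chooses a value for each index.
   Hence taking graphs is bijective on arrows. *)
Require Import Defs.

Set Implicit Arguments.
Unset Strict Implicit.
Local Open Scope type_scope.
Local Open Scope setoid_scope.
Local Arguments eqV : simpl never.
Local Arguments memV : simpl never.

Definition injective (A B : setoid) (f : Ext A B) : Type :=
  forall x y : A, f x == f y -> x == y.

Definition surjective (A B : setoid) (f : Ext A B) : Type :=
  forall y : B, {x : A & f x == y}.

(** A proof of surjectivity, being a Σ-valued function, already picks a preimage of each point;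
    injectivity makes the pick extensional. *)
Definition inverse (A B : setoid) (f : Ext A B) (i : injective f)
  (s : surjective f) : Ext B A.
Proof.
refine (@ExtFun B A (fun y => projT1 (s y)) _).
intros y z e; apply i.
exact (trans (projT2 (s y)) (trans e (sym (projT2 (s z))))).
Defined.

Lemma inverseK (A B : setoid) (f : Ext A B) (i : injective f)
  (s : surjective f) (y : B) : f (inverse i s y) == y.
Proof. exact (projT2 (s y)). Qed.

Section Bijective.
Variables (B C : category) (F : functor B C).
Hypotheses (i0 : injective (F0 F)) (i1 : injective (F1 F)).
Hypotheses (s0 : surjective (F0 F)) (s1 : surjective (F1 F)).

Lemma injective_F2 : injective (F2 F).
Proof.
intros u v e; apply C2_eq; apply i1.
- exact (trans (F_first F u) (trans (fn_ext first e) (sym (F_first F v)))).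
- exact (trans (F_second F u) (trans (fn_ext second e) (sym (F_second F v)))).
Qed.

Lemma surjective_F2 : surjective (F2 F).
Proof.
intro w.
destruct (s1 (first w)) as [f ef], (s1 (second w)) as [g eg].
(* The chosen preimages of the two components are composable: their images are, and injectivity of
   [F0] reflects this. *)
assert (c : dom g == cod f).
{ apply i0.
  refine (trans (F_dom F g) (trans (fn_ext dom eg) _)).
  refine (trans (sym (cod_first w)) (trans (fn_ext cod (sym ef)) _)).
  exact (sym (F_cod F f)). }
destruct (C2_ex c) as [u [ug uf]]; exists u; apply C2_eq.
- exact (trans (sym (F_first F u)) (trans (fn_ext (F1 F) uf) ef)).
- exact (trans (sym (F_second F u)) (trans (fn_ext (F1 F) ug) eg)).
Qed.

(** Each functor law is checked after applying [F], which is injective: there the inverses cancel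
    and the law becomes that of [F]. *)
Definition inverse_functor : functor C B.
Proof.
pose (G0 := inverse i0 s0); pose (G1 := inverse i1 s1).
pose (G2 := inverse injective_F2 surjective_F2).
pose proof (inverseK i0 s0) as K0; pose proof (inverseK i1 s1) as K1.
pose proof (inverseK injective_F2 surjective_F2) as K2.
refine (@Functor C B G0 G1 G2 _ _ _ _ _ _).
- intro x; apply i1; refine (trans (K1 _) (sym _)).
  exact (trans (F_idn F _) (fn_ext idn (K0 x))).
- intro f; apply i0; refine (trans (K0 _) (sym _)).
  exact (trans (F_dom F _) (fn_ext dom (K1 f))).
- intro f; apply i0; refine (trans (K0 _) (sym _)).
  exact (trans (F_cod F _) (fn_ext cod (K1 f))).
- intro u; apply i1; refine (trans (K1 _) (sym _)).
  exact (trans (F_first F _) (fn_ext first (K2 u))).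
- intro u; apply i1; refine (trans (K1 _) (sym _)).
  exact (trans (F_second F _) (fn_ext second (K2 u))).
- intro u; apply i1; refine (trans (K1 _) (sym _)).
  exact (trans (F_cmp F _) (fn_ext cmp (K2 u))).
Defined.

Lemma isomorphic_of_bijective : isomorphic B C.
Proof.
exists F, inverse_functor; split; (split; [split|]); intro x; simpl.
- exact (i0 (inverseK i0 s0 (F0 F x))).
- exact (i1 (inverseK i1 s1 (F1 F x))).
- exact (injective_F2 (inverseK injective_F2 surjective_F2 (F2 F x))).
- exact (inverseK i0 s0 x).
- exact (inverseK i1 s1 x).
- exact (inverseK injective_F2 surjective_F2 x).
Qed.

End Bijective.

Definition graph (a b : V) (f : index a -> index b) : V :=
  sup (index a) (fun i => ⟨elt a i, elt b (f i)⟩).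

Lemma graphI (a b : V) (f : Ext (Rbar a) (Rbar b)) (x y : V) (i : index a) :
  eqV x (elt a i) -> eqV y (elt b (f i)) -> memV ⟨x, y⟩ (graph f).
Proof. intros e e'; exists i; exact (opair_eq e e'). Qed.

(** Membership may be witnessed by an index [j] other than [i], but both name [x], so extensionality
    of [f] identifies the two values. *)
Lemma graphE (a b : V) (f : Ext (Rbar a) (Rbar b)) (x y : V) (i : index a) :
  eqV x (elt a i) -> memV ⟨x, y⟩ (graph f) -> eqV y (elt b (f i)).
Proof.
intros e [j m]; apply opair_inj in m; destruct m as [ex ey].
apply (eqV_trans ey); apply (fn_ext f (x := j) (y := i)).
exact (eqV_trans (eqV_sym ex) e).
Qed.

Lemma graph_tf (a b : V) (f : Ext (Rbar a) (Rbar b)) :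
  total_functional a b (graph f).
Proof.
repeat split.
- intros t [i e]; exists (elt a i), (elt b (f i)).
  repeat split; try apply memV_elt; exact e.
- intros x m; destruct (memV_inv m) as [i e]; exists (elt b (f i)).
  split; [apply memV_elt|exact (graphI (f := f) e (eqV_refl _))].
- intros x y y' m m'.
  assert (mx : memV x a).
  { destruct m as [i e]; exact (memV_eql (fst (opair_inj e)) (memV_elt i)). }
  destruct (memV_inv mx) as [i ex].
  exact (eqV_trans (graphE ex m) (eqV_sym (graphE ex m'))).
Qed.

Local Notation CR := (cat_of_family Rbar).

Definition graph_arrow (h : C1 CR) : C1 Vcat := mkV1 (graph_tf (fam_fun h)).

(** Index [i] is sent along [p] to an index of the other domain; the commuting square [H] matches
    the second coordinates. *)
Lemma graph_arrow_mem (h k : C1 CR) : h == k ->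
  forall t, memV t (graph (fam_fun h)) -> memV t (graph (fam_fun k)).
Proof.
destruct h as [a [b f]], k as [a' [b' f']]; intros [p [q H]] t [i e].
apply (memV_eql e); apply (graphI (f := f') (i := Rbar_fn p i)).
- exact (Rbar_fnP p i).
- exact (eqV_trans (Rbar_fnP q (f i)) (H i)).
Qed.

Definition graph_F1 : Ext (C1 CR) (C1 Vcat).
Proof.
refine (@ExtFun (C1 CR) (C1 Vcat) graph_arrow _).
intros h k e; apply V1_eq.
- exact (fn_ext (@dom CR) e).
- exact (fn_ext (@cod CR) e).
- apply eqV_ext; apply graph_arrow_mem; [exact e|exact (sym e)].
Defined.

Definition graph_F2 : Ext (C2 CR) (C2 Vcat).
Proof.
refine (@ExtFun (C2 CR) (C2 Vcat)
  (fun u => existT _ ⟨projT1 (graph_F1 (first u)), projT1 (graph_F1 (second u))⟩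
     (existT _ (graph_F1 (first u)) (existT _ (graph_F1 (second u))
        (eqV_refl _, cod_first u)))) _).
intros u v [e e']; apply V2_eq; [exact (fn_ext graph_F1 e)|exact (fn_ext graph_F1 e')].
Defined.

Lemma graph_cmp (u : C2 CR) : graph_F1 (cmp u) == cmp (graph_F2 u).
Proof.
apply V1_eq; try apply eqV_refl.
apply eqV_ext; intros t m.
- destruct u as [[a [b f]] [[b' [c g]] p]]; destruct m as [i e].
  (* The middle point [elt b (f i)] equals in [V] the element of [b'] at the transported index,
     where [g] is evaluated. *)
  apply (memV_eql e), (@comp_memI _ _ (elt b (f i))).
  + exact (graphI (f := f) (eqV_refl _) (eqV_refl _)).
  + exact (graphI (f := g) (Rbar_fnP p (f i)) (eqV_refl _)).
- destruct (comp_memE m) as [x [y [z [[e l] n]]]].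
  destruct u as [[a [b f]] [[b' [c g]] p]].
  destruct (memV_inv (fst (tf_mem (graph_tf f) l))) as [i ex].
  apply (memV_eql e), (@graphI _ _ _ x z i ex).
  refine (graphE (f := g) _ n).
  exact (eqV_trans (graphE (f := f) ex l) (Rbar_fnP p (f i))).
Qed.

Definition graph_functor : functor CR Vcat.
Proof.
refine (@Functor CR Vcat (ext_id _) graph_F1 graph_F2 _ _ _ _ _ graph_cmp);
  intro; apply eqV_refl.
Defined.

(** Injectivity of ordered pairs supplies [p] and [q]. Each pair of the first graph lies in the
    second, and reading it at the index [Rbar_fn p i] gives the commuting square. *)
Lemma graph_F1_injective : injective graph_F1.
Proof.
intros [a [b f]] [a' [b' f']] e; destruct (V1_inj e) as [[p q] r].
exists p, q; intro i; simpl.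
apply (eqV_trans (eqV_sym (Rbar_fnP q (f i)))).
refine (graphE (f := f') (Rbar_fnP p i) (memV_eqr r _)).
exact (graphI (f := f) (eqV_refl _) (eqV_refl _)).
Qed.

Section Choice.
Variables (a b r : V) (t : total_functional a b r).

(** Totality gives an element of [V]; its membership proof in [b] supplies the index. *)
Definition value (i : index a) : {j : index b & memV ⟨elt a i, elt b j⟩ r}.
Proof.
destruct (snd (fst t) _ (memV_elt i)) as [y [my m]].
destruct (memV_inv my) as [j e]; exists j.
exact (memV_eql (opair_eq (eqV_refl _) (eqV_sym e)) m).
Defined.

Definition function_of : Ext (Rbar a) (Rbar b).
Proof.
refine (@ExtFun (Rbar a) (Rbar b) (fun i => projT1 (value i)) _).
(* Values at equal indices are chosen independently; functionality of [r] makes them equal. *)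
intros i j e; apply (snd t (elt a i) _ _ (projT2 (value i))).
exact (memV_eql (opair_eq e (eqV_refl _)) (projT2 (value j))).
Defined.

Lemma graph_function_of : eqV (graph function_of) r.
Proof.
apply eqV_ext; intros s m.
- destruct m as [i e]; exact (memV_eql e (projT2 (value i))).
- destruct (fst (fst t) s m) as [x [y [[mx my] e]]].
  destruct (memV_inv mx) as [i ex].
  apply (memV_eql e), (graphI (f := function_of) ex).
  (* Both [y] and the chosen value are related to [x] by [r], so functionality forces them to
     agree. *)
  apply (snd t x); [exact (memV_eql (eqV_sym e) m)|].
  exact (memV_eql (opair_eq ex (eqV_refl _)) (projT2 (value i))).
Qed.

End Choice.

Lemma graph_F1_surjective : surjective graph_F1.
Proof.
intro u; exists (mk_arrow (function_of (V1_tf u))).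
apply V1_eq; try apply eqV_refl; apply graph_function_of.
Qed.

Theorem theorem5p5 : isomorphic (cat_of_family Rbar) Vcat.
Proof.
apply (isomorphic_of_bijective (F := graph_functor)).
- exact (fun x y e => e).
- exact graph_F1_injective.
- intro x; exists x; apply eqV_refl.
- exact graph_F1_surjective.
Qed.
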